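(* Let $n\ge2$. Every simple (undirected, loopless) quantum graph on $M_n$ of the form $X_{\cdot,B}$, i.e. with $B\in M_n$ a real symmetric projector satisfying $B\mathbf 1=0$, is $n$-colourable.
   Context: $M_n=M_n(\mathbb C)$; ''projector'' means orthogonal projector; $\mathbf 1\in\mathbb C^n$ is the all-ones vector. $X_{\cdot,B}$ is the quantum graph on $M_n$ with adjacency operator the Schur multiplier $x\mapsto (B_{ij}x_{ij})_{i,j}$; its operator space is $S=\{\operatorname{diag}(v): v\in\operatorname{img}B\}\subseteq M_n$. A quantum graph with operator space $S$ is $k$-colourable if there exist non-zero projectors $P_1,\dots,P_k$ on $\mathbb C^n$ with $\sum_sP_s=I$ and $P_sxP_s=0$ for all $x\in S$ and all $s\in\{1,\dots,k\}$. *)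

(* Defs.v *)
From HB Require Import structures.
From mathcomp Require Import all_boot all_order all_algebra.
From mathcomp Require Import complex spectral sesquilinear.
From mathcomp Require Import reals.

Set Implicit Arguments.
Unset Strict Implicit.
Unset Printing Implicit Defensive.
Import Order.TTheory GRing.Theory Num.Theory.
Local Open Scope ring_scope.
Local Open Scope sesquilinear_scope.

Definition is_projector (C : numClosedFieldType) (n : nat) (P : 'M[C]_n) : Prop :=
  P *m P = P /\ P ^t* = P.

Definition schur_multiplier (C : numClosedFieldType) (n : nat) (B : 'M[C]_n)
    (x : 'M[C]_n) : 'M[C]_n :=
  \matrix_(i, j) (B i j * x i j).

(* If A x = \sum_r K_r *m x *m K_r ^t*, then A E_(a,b) has (i, j) entry
   \sum_r K_r i a * (K_r j b)^*, so that for fixed p = (j, b) the matrix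
   (A E_(a,b) i j)_(i,a) is a combination of the Kraus operators K_r; over all
   p these matrices span the Kraus operators, i.e. the operator space of A.
   For A = schur_multiplier B this is {diag v : v \in img B}: see
   [operator_space_schurP]. *)
Definition choi_slice (C : numClosedFieldType) (n : nat)
    (A : 'M[C]_n -> 'M[C]_n) (p : 'I_n * 'I_n) : 'M[C]_n :=
  \matrix_(i, a) A (delta_mx a p.2) i p.1.

Definition operator_space (C : numClosedFieldType) (n : nat)
    (A : 'M[C]_n -> 'M[C]_n) : {vspace 'M[C]_n} :=
  <<[seq choi_slice A p | p : 'I_n * 'I_n]>>%VS.

Definition colourable (C : numClosedFieldType) (n k : nat)
    (S : {vspace 'M[C]_n}) : Prop :=
  exists P : 'I_k -> 'M[C]_n,
    [/\ forall s, is_projector (P s),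
        forall s, P s != 0,
        \sum_s P s = 1%:M
      & forall x s, x \in S -> P s *m x *m P s = 0].

Lemma choi_slice_schur (C : numClosedFieldType) (n : nat) (B : 'M[C]_n)
    (p : 'I_n * 'I_n) :
  choi_slice (schur_multiplier B) p =
  (p.1 == p.2)%:R *: diag_mx (col p.1 B)^T.
Proof.
apply/matrixP => i a; rewrite !mxE.
case: p => j b /=; have [-> | _] := eqVneq j b; last by rewrite andbF mulr0 mul0r.
by rewrite andbT mul1r mulr_natr; case: eqVneq => [->|].
Qed.

Lemma operator_space_schurP (C : numClosedFieldType) (n : nat) (B x : 'M[C]_n) :
  x \in operator_space (schur_multiplier B) <->
  exists w : 'cV[C]_n, x = diag_mx (B *m w)^T.
Proof.
have mulE (w : 'cV[C]_n) :
    diag_mx (B *m w)^T = \sum_j w j 0 *: diag_mx (col j B)^T.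
  apply/matrixP => i a; rewrite summxE !mxE -sumrMnl.
  by apply: eq_bigr => j _; rewrite !mxE mulrnAr mulrC.
split=> [xS | [w ->]].
  have := coord_span (X := in_tuple _) xS; set X := in_tuple _.
  move=> ->; elim/big_ind: _ => [|_ _ [u ->] [v ->] | i _].
  - by exists 0; rewrite mulmx0 trmx0 linear0.
  - by exists (u + v); rewrite mulmxDr linearD linearD.
  - have /mapP [p _ ->] : X`_i \in [seq choi_slice (schur_multiplier B) p | p : 'I_n * 'I_n].
      exact: mem_nth.
    rewrite choi_slice_schur scalerA.
    set c := _ * _; exists (c *: delta_mx p.1 0).
    by rewrite -scalemxAr -colE !linearZ.
rewrite mulE; apply: rpred_sum => j _; apply: rpredZ.
apply: memv_span; apply/mapP; exists (j, j); first by rewrite mem_enum.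
by rewrite choi_slice_schur eqxx scale1r.
Qed.

(* Main.v *)
(* Take for the P_s the rank-one projectors onto the vectors u_s of the Fourier
   basis.  All entries of u_s have squared modulus 1/n, so
   u_s^* diag(v) u_s = (1/n) 1^T v, and 1^T v = 0 for v in img B because
   1^T B = (B 1)^T = 0. *)
Require Import Defs.
From HB Require Import structures.
From mathcomp Require Import all_boot all_order all_algebra.
From mathcomp Require Import complex spectral sesquilinear.
From mathcomp Require Import separable cyclic cyclotomic.
From mathcomp Require Import reals.

Set Implicit Arguments.
Unset Strict Implicit.
Unset Printing Implicit Defensive.
Import Order.TTheory GRing.Theory Num.Theory.
Local Open Scope ring_scope.
Local Open Scope sesquilinear_scope.

(** ['X^n - 1] splits over [C] and is separable because [n] is non-zero in [C]; its [n] distinct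
    roots, all [n]-th roots of unity, must include a primitive one. *)
Lemma numClosed_prim_root_exists (C : numClosedFieldType) (n : nat) :
  (0 < n)%N -> exists z : C, n.-primitive_root z.
Proof.
move=> n_gt0; have [rs Drs] := closed_field_poly_normal ('X^n - 1 : {poly C}).
rewrite (monicP (monicXnsubC 1 n_gt0)) scale1r in Drs.
have nR : n%:R != 0 :> C by rewrite pnatr_eq0 -lt0n.
have sz : (n <= size rs)%N.
  by rewrite -ltnS -(size_prod_XsubC rs id) -Drs size_XnsubC.
have rs_uniq : uniq rs.
  by rewrite -separable_prod_XsubC -Drs separable_Xn_sub_1.
have rs_root : all n.-unity_root rs.
  by apply/allP => z; rewrite -root_prod_XsubC -Drs.
by have /hasP[z _ z_prim] := has_prim_root n_gt0 rs_root rs_uniq sz; exists z.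
Qed.

Lemma sum_expr_unity_root (F : idomainType) (n : nat) (w : F) :
  w ^+ n = 1 -> w != 1 -> \sum_(i < n) w ^+ i = 0.
Proof.
move=> wn w1; apply: (mulfI (x := w - 1)); first by rewrite subr_eq0.
by rewrite -subrX1 wn subrr mulr0.
Qed.

(** The witness is the Fourier matrix with entries [z ^+ (s * i)] divided by the square root of [n],
    for a primitive [n]-th root of unity [z]. *)
Lemma flat_unitarymx_exists (C : numClosedFieldType) (n : nat) :
  (0 < n)%N ->
  exists2 U : 'M[C]_n, U \is unitarymx &
    forall s i, U s i * (U s i)^* = n%:R^-1.
Proof.
move=> n_gt0; have [z z_prim] := numClosed_prim_root_exists C n_gt0.
have nz : n%:R != 0 :> C by rewrite pnatr_eq0 -lt0n.
have zn : z ^+ n = 1 := prim_expr_order z_prim.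
have z_norm : `|z| = 1.
  by apply/eqP; rewrite -(pexpr_eq1 n_gt0) // -normrX zn normr1.
have zJ k : (z ^+ k)^* = (z ^+ k)^-1.
  by rewrite [RHS]invC_norm normrX z_norm !expr1n invr1 mul1r.
have z_neq0 k : z ^+ k != 0.
  by rewrite expf_neq0 // -normr_eq0 z_norm oner_eq0.
have cJ : (sqrtC n%:R : C)^-1 * ((sqrtC n%:R)^-1)^* = n%:R^-1.
  rewrite conj_Creal; first by rewrite -invfM -expr2 sqrtCK.
  by rewrite realV ger0_real // sqrtC_ge0 ler0n.
exists (\matrix_(s, i) ((sqrtC n%:R)^-1 * z ^+ (s * i))); last first.
  by move=> s i; rewrite !mxE rmorphM /= mulrACA cJ zJ divff ?mulr1.
apply/unitarymxP/matrixP => s t; rewrite !mxE.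
(* Since [z] has modulus 1, conjugation inverts its powers, and the inner product of rows [s] and
   [t] becomes a geometric sum. *)
transitivity (n%:R^-1 * \sum_(i < n) (z ^+ s / z ^+ t) ^+ i).
  rewrite big_distrr; apply: eq_bigr => i _.
  by rewrite !mxE rmorphM /= mulrACA cJ zJ expr_div_n !exprM.
have [-> | st] := eqVneq s t.
  rewrite divff // (eq_bigr (fun=> 1)) => [|i _]; last exact: expr1n.
  by rewrite sumr_const card_ord mulVf.
rewrite sum_expr_unity_root ?mulr0 //.
  by rewrite expr_div_n -!exprM !(mulnC _ n) !exprM zn !expr1n divr1.
(* The ratio is 1 only if [s] and [t] agree modulo the order [n] of [z]; both are below [n], so they
   are equal. *)
apply: contra_neq st => /divr1_eq /eqP.
rewrite (eq_prim_root_expr z_prim) !modn_small // => /eqP.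
exact: val_inj.
Qed.

(** The colour class of [s] is the line spanned by the column [(row s U)^t*]. Compressing
    [diag_mx v] to it leaves the scalar [n%:R^-1 * \sum_i v 0 i], which vanishes. *)
Lemma flat_unitarymx_colourable (C : numClosedFieldType) (n : nat)
    (U : 'M[C]_n) (S : {vspace 'M[C]_n}) :
    U \is unitarymx -> (forall s i, U s i * (U s i)^* = n%:R^-1) ->
    (forall x, x \in S -> exists2 v : 'rV_n, x = diag_mx v & \sum_i v 0 i = 0) ->
  colourable n S.
Proof.
move=> U_unit U_flat S_diag.
have rowU s : row s U *m (row s U)^t* = 1%:M.
  apply/rowP => i; rewrite (ord1 i).
  have /matrixP/(_ s s) := unitarymxP U_unit.
  by rewrite !mxE eqxx => <-; apply: eq_bigr => j _; rewrite !mxE.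
exists (fun s => (row s U)^t* *m row s U); split.
- move=> s; split; first by rewrite mulmxA -(mulmxA _ (row s U)) rowU mulmx1.
  by rewrite trmx_mul map_mxM trmxCK.
- move=> s; apply/eqP => P0.
  have /matrixP/(_ 0 0)/eqP : (1%:M : 'M[C]_1) = 0.
    by rewrite -[1%:M]mulmx1 -(rowU s) mulmxA -(mulmxA (row s U)) P0 mulmx0 mul0mx.
  by rewrite !mxE oner_eq0.
(* The rank-one projectors add up to [U^t* *m U]. *)
- have U1 : U^t* *m U = 1%:M by apply/mulmx1C/unitarymxP.
  rewrite -U1; apply/matrixP => i j; rewrite summxE !mxE.
  by apply: eq_bigr => s _; rewrite !mxE big_ord1 !mxE.
- move=> x s /S_diag[v -> v0].
  have uvu : row s U *m diag_mx v *m (row s U)^t* = 0.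
    apply/rowP => i; rewrite (ord1 i) mul_mx_diag !mxE.
    under eq_bigr => j _ do rewrite !mxE mulrAC U_flat.
    by rewrite -big_distrr /= v0 mulr0.
  rewrite !mulmxA -(mulmxA _ (row s U)) -(mulmxA _ _ ((row s U)^t*)).
  by rewrite uvu mulmx0 mul0mx.
Qed.

Theorem proposition4p19 (R : realType) (n : nat) (hn : (2 <= n)%N)
    (B : 'M[R[i]]_n)
    (B_projector : is_projector B)
    (B_real : B \is a mxOver Num.real)
    (B_symmetric : B^T = B)
    (B_loopless : B *m (const_mx 1 : 'cV[R[i]]_n) = 0) :
  colourable n (operator_space (schur_multiplier B)).
Proof.
have [U U_unit U_flat] := flat_unitarymx_exists R[i] (ltnW hn).
apply: (flat_unitarymx_colourable U_unit U_flat) => x.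
case/operator_space_schurP => w ->; exists (B *m w)^T => //.
(* The only entry of this product is the sum of the entries of [B *m w]. *)
have : (B *m w)^T *m (const_mx 1 : 'cV_n) = 0.
  by rewrite trmx_mul B_symmetric -mulmxA B_loopless mulmx0.
move=> /matrixP/(_ 0 0); rewrite !mxE; apply: etrans.
by apply: eq_bigr => i _; rewrite [const_mx _ _ _]mxE mulr1.
Qed.
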